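(* Let $\mathcal{C}=\{\varphi_1,\dots,\varphi_N\}$ be a hyperbolic IFS on $K$ and let $\mu$ be its invariant (Hutchinson) measure. Then $\mathcal{C}$ has exponential decay of correlations over the real Lipschitz functions on $K$: there exist constants $0<\xi<1$ and $M>0$ such that for all Lipschitz functions $g_1,g_2:K\to\mathbb{R}$ and all $n\ge1$, $$\left|\int_{\Sigma_A^+}C_n(g_1,g_2)(\underline{x})\,dm(\underline{x})\right|\le M\,\xi^n\,\|g_1\|_{Lip}\,\|g_2\|_{Lip}.$$
   Context: $(K,d)$ is a compact metric space with $\operatorname{diam}(K)=1$. A hyperbolic IFS is a finite family of contractions $\varphi_i:K\to K$, $i=1,\dots,N$ (each Lipschitz with constant $<1$). Let $(p_1,\dots,p_N)$ be a probability vector. The associated invariant (Hutchinson) measure $\mu$ is the Borel probability on $K$ satisfying $\mu=\sum_{i=1}^Np_i\,\varphi_i^*\mu$, where $\varphi_i^*\mu(E)=\mu(\varphi_i^{-1}(E))$. Here $\Sigma_A^+=\{1,\dots,N\}^{\mathbb{N}}$ is the full one-sided shift space of sequences $\underline{x}=(x_0,x_1,\dots)$ (all entries of $A$ equal $1$), and $m$ is the Bernoulli measure on $\Sigma_A^+$ defined by $(p_1,\dots,p_N)$. For $\underline{x}\in\Sigma_A^+$ define $\Phi_n(\underline{x}):K\to K$ by $\Phi_n(\underline{x})(y)=\varphi_{x_n}\circ\varphi_{x_{n-1}}\circ\cdots\circ\varphi_{x_0}(y)$. The $\underline{x}$-coefficient of correlation of $g_1,g_2:K\to\mathbb{R}$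 is $$C_n(g_1,g_2)(\underline{x})=\int_Kg_1\,(g_2\circ\Phi_n(\underline{x}))\,d\mu-\int_Kg_1\,d\mu\int_Kg_2\circ\Phi_n(\underline{x})\,d\mu.$$ For Lipschitz $g:K\to\mathbb{R}$, $\|g\|_{Lip}$ is the sum of the sup norm and the Lipschitz constant of $g$. *)

(* Defs.v *)
From HB Require Import structures.
From mathcomp Require Import all_boot all_order all_algebra.
From mathcomp Require Import all_classical all_reals all_analysis.

Set Implicit Arguments.
Unset Strict Implicit.
Unset Printing Implicit Defensive.

Import Order.TTheory GRing.Theory Num.Theory.
Import numFieldNormedType.Exports.

Local Open Scope classical_set_scope.
Local Open Scope ring_scope.

(* The base point is only there because [measurableType] extends [pointedType];
   a metric space of diameter 1 is nonempty anyway. *)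
#[short(type="pmetricType")]
HB.structure Definition PointedMetric (R : numDomainType) :=
  {M of Metric R M & isPointed M}.

HB.instance Definition _ (n : nat) := isPointed.Build 'I_n.+1 ord0.

Section Metric.
Context {R : realType}.

Definition diam (X : metricType R) : R :=
  sup [set mdist xy.1 xy.2 | xy in [set: X * X]].

(* [lipschitz_on] of the library is restricted to normed modules. *)
Definition klipschitz (X Y : metricType R) (k : R) (f : X -> Y) : Prop :=
  forall x y, mdist (f x) (f y) <= k * mdist x y.

Definition metric_contraction (X : metricType R) (f : X -> X) : Prop :=
  exists k, 0 <= k < 1 /\ klipschitz k f.

Definition is_lipschitz (X : metricType R) (g : X -> R) : Prop :=
  exists k, klipschitz k (g : X -> R^o).

Definition sup_norm (X : metricType R) (g : X -> R) : R :=
  sup [set `|g x| | x in [set: X]].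

Definition lip_const (X : metricType R) (g : X -> R) : R :=
  inf [set k | 0 <= k /\ klipschitz k (g : X -> R^o)].

Definition lip_norm (X : metricType R) (g : X -> R) : R :=
  sup_norm g + lip_const g.

End Metric.

Definition borel {R : realType} (K : pmetricType R) :=
  g_sigma_algebraType (@open K).

Section IFS.
Context {R : realType} {N : nat} (K : pmetricType R).
Implicit Types (p : 'I_N.+1 -> R) (phi : 'I_N.+1 -> K -> K).

Definition probability_vector p : Prop :=
  (forall i, 0 <= p i) /\ \sum_i p i = 1.

Definition hyperbolic_ifs phi : Prop := forall i, metric_contraction (phi i).

Definition hutchinson_measure p phi (mu : probability (borel K) R) : Prop :=
  forall E : set (borel K), measurable E ->
    mu E = (\sum_i (p i)%:E * pushforward mu (phi i : borel K -> borel K) E)%E.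

End IFS.

Section Shift.
Context (N : nat).

Definition cylinder (w : seq 'I_N.+1) : set (nat -> 'I_N.+1) :=
  [set x | forall k, (k < size w)%N -> x k = nth ord0 w k].

(* The full one-sided shift on N + 1 symbols; since the alphabet is finite, the
   cylinders generate the Borel sigma-algebra of the product topology. *)
Definition full_shift := g_sigma_algebraType (range cylinder).

(* Cylinders are stable under intersection up to the empty set, so this
   determines [m]. *)
Definition bernoulli_measure {R : realType} (p : 'I_N.+1 -> R)
    (m : probability full_shift R) : Prop :=
  forall w : seq 'I_N.+1, m (cylinder w) = (\prod_(i <- w) p i)%:E.

End Shift.

Section Correlations.
Context {R : realType} {N : nat} {K : pmetricType R}.

Fixpoint random_comp (phi : 'I_N.+1 -> K -> K) (n : nat) (x : full_shift N)
    : K -> K :=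
  if n is k.+1 then phi (x n) \o random_comp phi k x else phi (x 0%N).

Definition correlation (mu : probability (borel K) R)
    (phi : 'I_N.+1 -> K -> K) (n : nat) (g1 g2 : K -> R) (x : full_shift N)
    : R :=
  \int[mu]_y (g1 y * g2 (random_comp phi n x y)) -
  (\int[mu]_y g1 y) * (\int[mu]_y g2 (random_comp phi n x y)).

End Correlations.

(* Main.v *)
Require Import Defs.
From HB Require Import structures.
From mathcomp Require Import all_boot all_order all_algebra.
From mathcomp Require Import all_classical all_reals all_analysis.
From mathcomp Require Import measurable_realfun ring lra.

Set Implicit Arguments.
Unset Strict Implicit.
Unset Printing Implicit Defensive.

Import Order.TTheory GRing.Theory Num.Theory.
Import numFieldNormedType.Exports.

Local Open Scope classical_set_scope.
Local Open Scope ring_scope.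

(** The estimate holds pointwise in the shift space.  Let [l < 1] be a common
    Lipschitz constant of the maps of the system.  A composition of [n + 1] of
    them is [l ^ (n + 1)]-Lipschitz, and [K] has diameter [1], so the function
    [g2 \o random_comp phi n x] varies by at most [lip_const g2 * l ^ (n + 1)]
    on [K] ([klipschitz_random_comp]).  The covariance of two functions under
    any probability is at most the supremum of the first times the oscillation
    of the second ([covariance_le_osc]); hence every correlation coefficient,
    and with it their average over the shift, is bounded by
    [sup_norm g1 * lip_const g2 * l ^ (n + 1)].

    The remaining work is measurability: Lipschitz functions are Borel, and a
    correlation coefficient depends on the first [n + 1] symbols only, so that
    its preimages are finite unions of cylinders. *)

(** * Lipschitz functions on a metric space *)

Section LipschitzFunctions.
Context {R : realType}.
Implicit Types X Y Z : metricType R.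

Lemma klipschitz_comp X Y Z (k l : R) (f : Y -> Z) (g : X -> Y) :
  0 <= k -> klipschitz k f -> klipschitz l g -> klipschitz (k * l) (f \o g).
Proof.
move=> k0 fk gl x y; apply: (le_trans (fk _ _)).
by rewrite -mulrA ler_wpM2l.
Qed.

Lemma klipschitz_le X Y (k l : R) (f : X -> Y) :
  k <= l -> klipschitz k f -> klipschitz l f.
Proof.
by move=> kl fk x y; apply: (le_trans (fk x y)); rewrite ler_wpM2r ?mdist_ge0.
Qed.

Lemma klipschitz_continuous X Y (k : R) (f : X -> Y) :
  klipschitz k f -> continuous f.
Proof.
move=> fk x; apply/metricType_numDomainType.cvgrPdist_lt => e e0.
have M0 : 0 < `|k| + 1 by rewrite ltr_wpDl.
apply/metricType_numDomainType.nbhs_mdistP.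
exists (e / (`|k| + 1)) => /=; first by rewrite divr_gt0.
move=> y /=; rewrite ltr_pdivlMr// mulrC; apply: le_lt_trans.
apply: (le_trans (fk x y)); rewrite ler_wpM2r ?mdist_ge0//.
by rewrite (le_trans (ler_norm _))// lerDl.
Qed.

(** The nonzero diameter is what makes distances bounded: the supremum of an
    unbounded set of reals is [0] by convention. *)
Lemma mdist_le_diam X (x y : X) : diam X != 0 -> mdist x y <= diam X.
Proof.
move=> d0; have [[_ ubX]|nsup] :=
    pselect (has_sup [set mdist z.1 z.2 | z in [set: X * X]]).
  by apply: ub_le_sup => //; exists (x, y).
by move/negP: d0; rewrite /diam sup_out// eqxx.
Qed.

(** The infimum of the admissible constants is admissible: for [x != y] each of
    them is at least [mdist (g x) (g y) / mdist x y]. *)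
Lemma klipschitz_lip_const X (g : X -> R) :
  is_lipschitz g -> klipschitz (lip_const g) (g : X -> R^o).
Proof.
move=> [k gk] x y; have [->|xy] := eqVneq x y; first by rewrite !mdistxx mulr0.
have d0 : 0 < mdist x y by rewrite mdist_gt0.
rewrite -ler_pdivrMr//; apply: lb_le_inf.
  exists `|k|; split => //.
  exact: klipschitz_le (ler_norm k) gk.
by move=> l [_ gl]; rewrite ler_pdivrMr.
Qed.

Lemma lip_const_ge0 X (g : X -> R) : is_lipschitz g -> 0 <= lip_const g.
Proof.
move=> [k gk]; apply: lb_le_inf; last by move=> l [].
by exists `|k|; split => //; exact: klipschitz_le (ler_norm k) gk.
Qed.

Lemma lipschitz_osc X (k : R) (g : X -> R) x y :
  diam X = 1 -> 0 <= k -> klipschitz k (g : X -> R^o) -> `|g x - g y| <= k.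
Proof.
move=> d1 k0 /(_ y x) gk; apply: (le_trans gk).
by rewrite ler_piMr// -d1 mdist_le_diam// d1 oner_neq0.
Qed.

Lemma le_sup_norm X (g : X -> R) x :
  diam X = 1 -> is_lipschitz g -> `|g x| <= sup_norm g.
Proof.
move=> d1 gL; apply: ub_le_sup; last by exists x.
exists (`|g x| + lip_const g) => _ [y _ <-].
rewrite -lerBlDl; apply: (le_trans (lerB_dist _ _)).
by apply: lipschitz_osc => //;
  [exact: lip_const_ge0|exact: klipschitz_lip_const].
Qed.

End LipschitzFunctions.

Lemma klipschitz_measurable {R : realType} (K : pmetricType R) (k : R)
    (g : K -> R) :
  klipschitz k (g : K -> R^o) -> measurable_fun setT (g : borel K -> R).
Proof.
move=> /klipschitz_continuous/continuousP gc.
apply: (measurability _ (RGenOpens.measurableE R)).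
move=> _ [_ [a [b ->] <-]]; rewrite setTI.
by apply: sub_sigma_algebra; exact/gc/interval_open.
Qed.

(** * Bounded functions on a probability space *)

Section Probability.
Context {d : measure_display} {T : measurableType d} {R : realType}.
Variable P : probability T R.
Implicit Types f g : T -> R.

Lemma le_bound_integrable f (c : R) :
  measurable_fun setT f -> (forall x, `|f x| <= c) ->
  P.-integrable setT (EFin \o f).
Proof.
move=> mf fc; apply: measurable_bounded_integrable => //.
  by rewrite /= probability_setT ltry.
exists c; split; first exact: num_real.
by move=> M cM x _; exact: le_trans (fc x) (ltW cM).
Qed.

Lemma Rintegral_cst_probability (c : R) : \int[P]_x c = c.
Proof. by rewrite Rintegral_cst//= probability_setT mulr1. Qed.

Lemma normr_Rintegral_le f (c : R) :
  measurable_fun setT f -> (forall x, `|f x| <= c) -> `|\int[P]_x f x| <= c.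
Proof.
move=> mf fc; have fi := le_bound_integrable mf fc.
apply: (le_trans (le_normr_Rintegral _ fi)) => //.
rewrite -[leRHS]Rintegral_cst_probability; apply: le_Rintegral => //.
  apply: (le_bound_integrable (c := c)); first exact: measurableT_comp.
  by move=> x; rewrite normr_id.
by apply: (le_bound_integrable (c := `|c|)).
Qed.

(** Write the covariance as the integral of [f * (g - \int g)]: as [\int g] is
    an average of values of [g], the second factor is at most the oscillation
    of [g]. *)
Lemma covariance_le_osc f g (a b : R) :
  measurable_fun setT f -> measurable_fun setT g ->
  (forall x, `|f x| <= a) -> (forall x y, `|g x - g y| <= b) ->
  `|\int[P]_x (f x * g x) - (\int[P]_x f x) * (\int[P]_x g x)| <= a * b.
Proof.
move=> mf mg fa gb.
have gB x : `|g x| <= `|g point| + b.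
  rewrite -lerBlDl; exact: le_trans (lerB_dist _ _) (gb _ _).
have gi := le_bound_integrable mg gB.
have fi := le_bound_integrable mf fa.
have ci c : P.-integrable setT (EFin \o (fun=> c : R)).
  by apply: (le_bound_integrable (c := `|c|)).
have fgi : P.-integrable setT (EFin \o (fun x => f x * g x)).
  apply: (le_bound_integrable (c := a * (`|g point| + b))).
    exact: measurable_funM.
  by move=> x; rewrite normrM ler_pM.
set I := \int[P]_x g x.
have gI x : `|g x - I| <= b.
  rewrite -[X in X - I](Rintegral_cst_probability (g x)) -RintegralB//.
  by apply: normr_Rintegral_le => //; apply: measurable_funB.
have fIi : P.-integrable setT (EFin \o (fun x => f x * I)).
  apply: (le_bound_integrable (c := a * `|I|)).
    exact: measurable_funM.
  by move=> x; rewrite normrM ler_wpM2r.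
rewrite -RintegralZr// -RintegralB//.
apply: normr_Rintegral_le.
  by apply: measurable_funB; apply: measurable_funM.
by move=> x; rewrite -mulrBr normrM ler_pM.
Qed.

End Probability.

(** * Functions of finitely many symbols *)

(** Such a function factors through the finite set of words of length [n], so
    the preimage of any set whatsoever is a finite union of cylinders. *)
Lemma finite_window_measurable {R : realType} (N n : nat)
    (F : full_shift N -> R) :
  (forall x y, (forall k, (k < n)%N -> x k = y k) -> F x = F y) ->
  measurable_fun setT F.
Proof.
move=> Fn _ Y _; rewrite setTI.
pose ext (w : n.-tuple 'I_N.+1) : full_shift N := nth ord0 w.
have -> : F @^-1` Y =
    \bigcup_(w in [set w | Y (F (ext w))]) cylinder (w : n.-tuple 'I_N.+1).
  apply/seteqP; split => [x /= Yx|x [w /= Yw xw]]; last first.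
    by rewrite (Fn x (ext w))// => k kn; apply: xw; rewrite size_tuple.
  have xE k : (k < n)%N -> x k = nth ord0 [tuple x i | i < n] k.
    by move=> kn; rewrite -[k]/(nat_of_ord (Ordinal kn)) -tnth_nth tnth_mktuple.
  exists [tuple x i | i < n].
    by rewrite /mkset (Fn _ x)// => k kn; rewrite xE.
  by move=> k; rewrite size_tuple; apply: xE.
apply: fin_bigcup_measurable; first exact: finite_finset.
by move=> w _; apply: sub_sigma_algebra; exists w.
Qed.

Section RandomCompositions.
Context {R : realType} {N : nat} {K : pmetricType R}.
Variable phi : 'I_N.+1 -> K -> K.

Lemma eq_random_comp n (x y : full_shift N) :
  (forall k, (k < n.+1)%N -> x k = y k) ->
  random_comp phi n x = random_comp phi n y.
Proof.
elim: n => [|n IH] xy /=; first by rewrite xy.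
by rewrite IH ?xy// => k kn; apply: xy; exact: ltnW.
Qed.

Lemma correlation_measurable (mu : probability (borel K) R) n (g1 g2 : K -> R) :
  measurable_fun setT (correlation mu phi n g1 g2).
Proof.
apply: (@finite_window_measurable R N n.+1) => x y xy.
by rewrite /correlation (eq_random_comp xy).
Qed.

Lemma klipschitz_random_comp (l : R) n x :
  0 <= l -> (forall i, klipschitz l (phi i)) ->
  klipschitz (l ^+ n.+1) (random_comp phi n x).
Proof.
move=> l0 phil; elim: n => [|n IH] /=; first by rewrite expr1.
by rewrite exprS; apply: klipschitz_comp.
Qed.

Lemma hyperbolic_ifs_ratio : hyperbolic_ifs phi ->
  exists2 l : R, 0 < l < 1 & forall i, klipschitz l (phi i).
Proof.
move=> /choice[k kphi].
(* The default value keeps the ratio positive when all the maps are constant. *)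
exists (\big[Num.max/2^-1]_i k i).
  apply/andP; split.
    by rewrite (lt_le_trans _ (bigmax_ge_id _ _ _ _))// invr_gt0.
  by apply/bigmax_ltP; split => [|i _]; [lra|have [/andP[]] := kphi i].
move=> i; apply: klipschitz_le (kphi i).2.
exact: le_bigmax.
Qed.

End RandomCompositions.

(** * Exponential decay of correlations *)

Lemma correlation_le {R : realType} (N : nat) (K : pmetricType R)
    (phi : 'I_N.+1 -> K -> K) (mu : probability (borel K) R) (l : R) n
    (g1 g2 : K -> R) (x : full_shift N) :
  diam K = 1 -> 0 <= l -> (forall i, klipschitz l (phi i)) ->
  is_lipschitz g1 -> is_lipschitz g2 ->
  `|correlation mu phi n g1 g2 x| <= sup_norm g1 * (lip_const g2 * l ^+ n.+1).
Proof.
move=> d1 l0 phil g1L g2L.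
have hL : klipschitz (lip_const g2 * l ^+ n.+1)
    (g2 \o random_comp phi n x : K -> R^o).
  apply: klipschitz_comp; first exact: lip_const_ge0.
    exact: klipschitz_lip_const.
  exact: klipschitz_random_comp.
apply: (@covariance_le_osc _ _ _ mu g1 (g2 \o random_comp phi n x)).
- exact: (klipschitz_measurable (klipschitz_lip_const g1L)).
- exact: klipschitz_measurable hL.
- by move=> y; exact: le_sup_norm.
- move=> y z; apply: lipschitz_osc hL => //.
  by rewrite mulr_ge0 ?exprn_ge0 ?lip_const_ge0.
Qed.

Theorem theorem8p5 (R : realType) (K : pmetricType R) (N : nat)
    (phi : 'I_N.+1 -> K -> K) (p : 'I_N.+1 -> R)
    (mu : probability (borel K) R) (m : probability (full_shift N) R) :
  compact [set: K] -> diam K = 1 ->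
  hyperbolic_ifs phi ->
  probability_vector p ->
  hutchinson_measure p phi mu ->
  bernoulli_measure p m ->
  exists xi M : R, [/\ 0 < xi < 1, 0 < M &
    forall g1 g2 : K -> R, is_lipschitz g1 -> is_lipschitz g2 ->
    forall n : nat, (1 <= n)%N ->
      `| \int[m]_x correlation mu phi n g1 g2 x |
        <= M * xi ^+ n * lip_norm g1 * lip_norm g2].
Proof.
move=> _ d1 /hyperbolic_ifs_ratio[l /andP[l0 l1] phil] _ _ _.
exists l, 1; split; [by rewrite l0|by []|move=> g1 g2 g1L g2L n _].
have S0 (g : K -> R) : is_lipschitz g -> 0 <= sup_norm g.
  by move=> gL; apply: (le_trans (normr_ge0 (g point))); exact: le_sup_norm.
have c1 := lip_const_ge0 g1L; have c2 := lip_const_ge0 g2L.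
have s1 := S0 _ g1L; have s2 := S0 _ g2L.
apply: (@le_trans _ _ (sup_norm g1 * (lip_const g2 * l ^+ n.+1))).
  apply: normr_Rintegral_le; first exact: correlation_measurable.
  by move=> x; apply: correlation_le => //; exact: ltW.
have -> : 1 * l ^+ n * lip_norm g1 * lip_norm g2 =
    lip_norm g1 * (lip_norm g2 * l ^+ n) by ring.
have ln0 : 0 <= l ^+ n by rewrite exprn_ge0// ltW.
apply: ler_pM => //; first by rewrite mulr_ge0// exprn_ge0// ltW.
  by rewrite lerDl.
apply: ler_pM => //; first by rewrite exprn_ge0// ltW.
  by rewrite lerDr.
by rewrite exprS ler_piMl// ltW.
Qed.
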